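(* Let $\Lambda,\mu,R>0$, $\rho=\Lambda/\mu$, and $C_1,C_2\ge0$ with $\max\{C_1,C_2\}>0$. In the observable infinite-server queue, the revenue-optimal threshold $n_m$, the socially optimal threshold $n_s$ and the individual equilibrium threshold $n_e$ satisfy $n_m\le n_s\le n_e$.
   Context: Customers arrive to an infinite-server system in a Poisson process of rate $\Lambda$; sojourn times are i.i.d. with mean $1/\mu$; $\rho=\Lambda/\mu$. A customer joining when $m$ customers are present has utility $R-(C_1m+C_2m^2)$; a balking customer has utility $0$. For $n\ge0$ let $$\mathbb{E}(L_n)=\frac{\rho\sum_{k=0}^{n-1}\rho^k/k!}{\sum_{k=0}^n\rho^k/k!}$$ (the expected queue length of the $M/G/n/n$ queue), with empty sums equal to $0$, so $\mathbb{E}(L_0)=0$. The three thresholds are as follows. (1) $n_e$ is the unique positive integer with $R-[C_1(n_e-1)+C_2(n_e-1)^2]\ge0$ and $R-[C_1n_e+C_2n_e^2]<0$. (2) $$n_s=\max\left\{N\ge 1:\ \frac{\rho\sum_{i=1}^2 C_i\left[\frac{\sum_{m=0}^{N-1}m^i\frac{\rho^m}{m!}}{\sum_{m=0}^{N}\frac{\rho^m}{m!}}-\frac{\sum_{m=0}^{N-2}m^i\frac{\rho^m}{m!}}{\sum_{m=0}^{N-1}\frac{\rho^m}{m!}}\right]}{\mathbb{E}(L_N)-\mathbb{E}(L_{N-1})}\le R\right\}.$$ It is the optimal threshold for the social welfare $$S^r(n)=\Lambda\,\frac{\sum_{m=0}^{n-1}\frac{\rho^m}{m!}[R-(C_1m+C_2m^2)]}{\sum_{k=0}^n\frac{\rho^k}{k!}}.$$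 (3) $$n_m=\max\left\{N\ge1:\ \frac{\sum_{i=1}^2C_i\bigl(\mathbb{E}(L_N)(N-1)^i-\mathbb{E}(L_{N-1})(N-2)^i\bigr)}{\mathbb{E}(L_N)-\mathbb{E}(L_{N-1})}\le R\right\}.$$ It is the optimal threshold for the revenue $S^r_m(n)=\mu\,\mathbb{E}(L_n)[R-(C_1(n-1)+C_2(n-1)^2)]$. *)

(* Defs.v *)
From mathcomp Require Import all_boot all_order all_algebra.
From mathcomp Require Import reals.

Set Implicit Arguments.
Unset Strict Implicit.
Unset Printing Implicit Defensive.

Import Order.TTheory GRing.Theory Num.Theory.

Local Open Scope ring_scope.

Section Thresholds.

Context {K : realType}.

(* [rho] is the offered load Lambda / mu, [V] the reward of a served customer
   (usually written R), and [C1 * m + C2 * m ^+ 2] the cost of joining when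
   [m] customers are present. *)
Implicit Types (rho V x : K) (n N i : nat).

(* Sums have exclusive upper bounds: [poisson_moment rho i n] is the sum of
   m ^ i * rho ^ m / m! over 0 <= m <= n - 1, hence 0 when n = 0. *)
Definition poisson_sum rho n : K := \sum_(m < n) rho ^+ m / (m`!)%:R.

Definition poisson_moment rho i n : K :=
  \sum_(m < n) m%:R ^+ i * (rho ^+ m / (m`!)%:R).

(* Mean number of customers in the M/G/n/n queue. *)
Definition mean_queue rho n : K :=
  rho * poisson_sum rho n / poisson_sum rho n.+1.

Definition joining_utility V (C1 C2 : K) x : K := V - (C1 * x + C2 * x ^+ 2).

Definition is_max (P : nat -> Prop) n : Prop :=
  P n /\ forall N, P N -> (N <= n)%N.

Definition is_equilibrium_threshold V (C1 C2 : K) n : Prop :=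
  [/\ (1 <= n)%N,
      0 <= joining_utility V C1 C2 (n%:R - 1)
    & joining_utility V C1 C2 n%:R < 0].

(* Only used for 1 <= N, where the truncated N - 1 is exact. *)
Definition social_increment rho i N : K :=
  poisson_moment rho i N / poisson_sum rho N.+1
  - poisson_moment rho i (N - 1) / poisson_sum rho N.

Definition social_ratio rho (C1 C2 : K) N : K :=
  rho * (C1 * social_increment rho 1 N + C2 * social_increment rho 2 N)
  / (mean_queue rho N - mean_queue rho (N - 1)).

Definition is_social_threshold rho V (C1 C2 : K) : nat -> Prop :=
  is_max (fun N => (1 <= N)%N /\ social_ratio rho C1 C2 N <= V).

(* N - 2 is taken in the field, so it is -1 at N = 1; its coefficient
   [mean_queue rho 0] is then 0. *)
Definition revenue_increment rho i N : K :=
  mean_queue rho N * (N%:R - 1) ^+ i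
  - mean_queue rho (N - 1) * (N%:R - 2) ^+ i.

Definition revenue_ratio rho (C1 C2 : K) N : K :=
  (C1 * revenue_increment rho 1 N + C2 * revenue_increment rho 2 N)
  / (mean_queue rho N - mean_queue rho (N - 1)).

Definition is_revenue_threshold rho V (C1 C2 : K) : nat -> Prop :=
  is_max (fun N => (1 <= N)%N /\ revenue_ratio rho C1 C2 N <= V).

End Thresholds.

(* Main.v *)
Require Import Defs.
From mathcomp Require Import all_boot all_order all_algebra.
From mathcomp Require Import reals.
From mathcomp Require Import ring lra.

Set Implicit Arguments.
Unset Strict Implicit.
Unset Printing Implicit Defensive.

Import Order.TTheory GRing.Theory Num.Theory.

Local Open Scope ring_scope.

(** Write p_m = rho^m / m! and c(m) = C1 m + C2 m^2, and let S_n be the sum of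
    the first n weights.  Clearing denominators, with the positive quantity
    D_M = S_{M+1} p_M - S_M p_{M+1}, the two ratios at N = M + 1 become
<<
      social  = c(M) + p_{M+1} * (sum_(m < M) (c(M) - c(m)) p_m) / D_M
      revenue = c(M) + S_M S_{M+2} (c(M) - c(M-1)) / D_M
>>
    ([social_ratioE] and [revenue_ratioE]).  Both corrections are nonnegative
    because c is increasing, and c(N - 1) <= social(N) <= R at N = n_s
    gives n_s <= n_e, since c exceeds R from n_e on.

    For n_m <= n_s it suffices that social <= revenue for every N.  As c is
    convex, c(M) - c(m) is at most M - m times its last increment
    c(M) - c(M-1), so everything reduces to the case of a linear cost,
<<
      p_{M+1} * sum_(m < M) (M - m) p_m <= S_M S_{M+2}.
>>
    This holds for every positive log-concave sequence
    ([logconcave_linear_gap]), by induction on M from the fact that S_k / p_k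
    is increasing.

    Finally both ratios are at least c(N - 1), which is unbounded, and both
    vanish at N = 1; so the maxima defining n_m and n_s exist. *)

(** * Partial sums of log-concave sequences *)

Section LogConcave.

Context (K : realFieldType) (p : nat -> K).
Context (p_gt0 : forall m, 0 < p m).
Context (p_logconcave : forall m, p m * p m.+2 <= p m.+1 ^+ 2).

Local Notation S n := (\sum_(m < n) p m).

Let S_recr n : S n.+1 = S n + p n.
Proof. by rewrite big_ord_recr. Qed.

Let S_ge0 n : 0 <= S n.
Proof. by apply: sumr_ge0 => m _; apply: ltW. Qed.

(** Log-concavity makes p_{k+1} / p_k nonincreasing, so a comparison between
    S_k / p_k and S_{k+1} / p_{k+1} survives a shift of the denominators. *)
Lemma logconcave_sum_shift k :
  S k * p k.+1 < S k.+1 * p k -> S k * p k.+2 < S k.+1 * p k.+1.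
Proof.
move=> IH; rewrite -(ltr_pM2r (p_gt0 k)).
have le1 : S k * (p k * p k.+2) <= S k * p k.+1 ^+ 2.
  by rewrite ler_wpM2l.
have lt1 : S k * p k.+1 * p k.+1 < S k.+1 * p k * p k.+1.
  by rewrite ltr_pM2r.
by lra.
Qed.

(** The ratio S_k / p_k is increasing; stated without division. *)
Lemma logconcave_sum_ratio k : S k * p k.+1 < S k.+1 * p k.
Proof.
elim: k => [|k /logconcave_sum_shift IH].
  by rewrite S_recr big_ord0 mul0r add0r mulr_gt0.
by rewrite (S_recr k.+1) {1}S_recr; have := p_logconcave k; lra.
Qed.

(** Passing from M to M + 1 adds S_{M+1} to the sum and S_{M+1} p_{M+2} to the
    bound S_{M+1} S_{M+2}; the old sum, now weighted by p_{M+2} instead of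
    p_{M+1}, is absorbed because S_M / p_{M+1} <= S_{M+1} / p_{M+2}. *)
Lemma logconcave_linear_gap M :
  p M.+1 * \sum_(m < M) (M%:R - m%:R) * p m <= S M * S M.+2.
Proof.
elim: M => [|M IH]; first by rewrite !big_ord0 mulr0 mul0r.
have -> : \sum_(m < M.+1) (M.+1%:R - m%:R) * p m
        = \sum_(m < M) (M%:R - m%:R) * p m + S M.+1.
  rewrite big_ord_recr /= S_recr addrA -big_split /=.
  by congr (_ + _); [apply: eq_bigr => m _|]; rewrite -natr1; ring.
set T := \sum_(m < M) _ in IH *.
have T_le : p M.+2 * T <= S M.+1 * S M.+2.
  rewrite -(ler_pM2r (p_gt0 M.+1)).
  have le1 : p M.+1 * T * p M.+2 <= S M * S M.+2 * p M.+2.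
    by rewrite ler_pM2r.
  have le2 : S M * p M.+2 * S M.+2 <= S M.+1 * p M.+1 * S M.+2.
    by rewrite ler_wpM2r // ltW // logconcave_sum_shift ?logconcave_sum_ratio.
  by lra.
by rewrite (S_recr M.+2); lra.
Qed.

End LogConcave.

(** * The two ratios and the joining cost *)

Definition poisson_weight (K : realType) (rho : K) m : K :=
  rho ^+ m / (m`!)%:R.

Definition joining_cost (K : realType) (C1 C2 x : K) : K :=
  C1 * x + C2 * x ^+ 2.

Section Comparison.

Context (K : realType) (rho C1 C2 : K).
Context (rho_gt0 : 0 < rho) (C1_ge0 : 0 <= C1) (C2_ge0 : 0 <= C2).

Local Notation p := (poisson_weight rho).
Local Notation S := (poisson_sum rho).
Local Notation c := (joining_cost C1 C2).

Let fact_neq0 m : (m`!)%:R != 0 :> K.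
Proof. by rewrite pnatr_eq0 -lt0n fact_gt0. Qed.

Lemma poisson_weight_gt0 m : 0 < p m.
Proof. by rewrite divr_gt0 ?exprn_gt0 // ltr0n fact_gt0. Qed.

Lemma poisson_weight_recr m : m.+1%:R * p m.+1 = rho * p m.
Proof.
have m1_neq0 : m.+1%:R != 0 :> K by rewrite pnatr_eq0.
rewrite /poisson_weight factS natrM exprS.
move: (fact_neq0 m) m1_neq0; move: (m.+1%:R) ((m`!)%:R) => a b b_neq0 a_neq0.
by field; rewrite a_neq0 b_neq0.
Qed.

(** By the recurrence, p_m p_{m+2} / p_{m+1}^2 = (m + 1) / (m + 2). *)
Lemma poisson_weight_logconcave m : p m * p m.+2 <= p m.+1 ^+ 2.
Proof.
have m2_gt0 : 0 < m.+2%:R :> K by rewrite ltr0n.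
rewrite -(ler_pM2l m2_gt0).
have -> : m.+2%:R * (p m * p m.+2) = m.+1%:R * p m.+1 ^+ 2.
  by rewrite mulrCA poisson_weight_recr mulrCA mulrA -poisson_weight_recr; ring.
by rewrite ler_wpM2r ?sqr_ge0 // ler_nat.
Qed.

Lemma cost_mono m n : (m <= n)%N -> c m%:R <= c n%:R.
Proof.
move=> le_mn; have lmn : m%:R <= n%:R :> K by rewrite ler_nat.
by rewrite lerD // ler_wpM2l // lerXn2r ?nnegrE ?ler0n.
Qed.

(** The difference of the two sides is C2 (M - m) (M - m - 1), which is
    nonnegative because m and M are integers. *)
Lemma cost_convex m M : (m < M)%N ->
  c M%:R - c m%:R <= (M%:R - m%:R) * (c M%:R - c (M%:R - 1)).
Proof.
move=> lt_mM; have lmM : m%:R + 1 <= M%:R :> K by rewrite natr1 ler_nat.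
rewrite -subr_ge0.
have -> : (M%:R - m%:R) * (c M%:R - c (M%:R - 1)) - (c M%:R - c m%:R)
    = C2 * ((M%:R - m%:R) * (M%:R - (m%:R + 1))) by rewrite /joining_cost; ring.
by rewrite !mulr_ge0 // subr_ge0 //; lra.
Qed.

Let S_gt0 n : 0 < S n.+1.
Proof.
rewrite /poisson_sum big_ord_recr /=.
rewrite ltr_wpDl ?poisson_weight_gt0 // sumr_ge0 // => m _.
exact/ltW/poisson_weight_gt0.
Qed.

Let S_ge0 n : 0 <= S n.
Proof. by case: n => [|n]; [rewrite /poisson_sum big_ord0 | rewrite ltW]. Qed.

Let S_recr n : S n.+1 = S n + p n.
Proof. by rewrite /poisson_sum big_ord_recr. Qed.

(** The numerator of S_{M+1} / p_{M+1} - S_M / p_M; up to positive factors it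
    is also the increment of the mean queue length. *)
Definition sum_ratio_gap M : K := S M.+1 * p M - S M * p M.+1.

Lemma sum_ratio_gap_gt0 M : 0 < sum_ratio_gap M.
Proof.
rewrite subr_gt0.
exact: (logconcave_sum_ratio poisson_weight_gt0 poisson_weight_logconcave).
Qed.

(** Customers who find m < M others pay c(m) rather than c(M); this is what they
    save in total under the stationary law, up to normalisation. *)
Definition cost_saving M : K := \sum_(m < M) (c M%:R - c m%:R) * p m.

Lemma mean_queue_incr M :
  mean_queue rho M.+1 - mean_queue rho M
  = rho * sum_ratio_gap M / (S M.+1 * S M.+2).
Proof.
rewrite /mean_queue /sum_ratio_gap.
have := S_gt0 M; have := S_gt0 M.+1; rewrite (S_recr M.+1) (S_recr M).
move=> /lt0r_neq0 h2 /lt0r_neq0 h1; field; by rewrite h1 h2.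
Qed.

(** Here F_{M+1} = F_M + c(M) p_M for the cost moments F, so the numerator is
    c(M) p_M S_{M+1} - F_M p_{M+1}; subtracting c(M) times the denominator
    leaves p_{M+1} (c(M) S_M - F_M). *)
Lemma social_ratioE M :
  social_ratio rho C1 C2 M.+1 =
  c M%:R + p M.+1 * cost_saving M / sum_ratio_gap M.
Proof.
pose F n := C1 * poisson_moment rho 1 n + C2 * poisson_moment rho 2 n.
have F_recr n : F n.+1 = F n + c n%:R * p n.
  by rewrite /F /poisson_moment !big_ord_recr /= -/(p n) /joining_cost; ring.
have savingE : cost_saving M = c M%:R * S M - F M.
  rewrite /cost_saving /F /poisson_sum /poisson_moment !mulr_sumr.
  rewrite -big_split -sumrB /=.
  by apply: eq_bigr => m _; rewrite -/(p m) /joining_cost; ring.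
have numE : C1 * social_increment rho 1 M.+1 + C2 * social_increment rho 2 M.+1
    = F M.+1 / S M.+2 - F M / S M.+1.
  by rewrite /social_increment subn1 /= /F; ring.
rewrite /social_ratio numE subn1 /= mean_queue_incr savingE F_recr.
have := lt0r_neq0 (sum_ratio_gap_gt0 M); have := lt0r_neq0 (S_gt0 M).
have := lt0r_neq0 (S_gt0 M.+1); have := lt0r_neq0 rho_gt0.
rewrite /sum_ratio_gap (S_recr M.+1) (S_recr M) => h0 h1 h2 h3.
by field; rewrite h0 h1 h2 h3.
Qed.

Lemma revenue_ratioE M :
  revenue_ratio rho C1 C2 M.+1
  = c M%:R + S M * S M.+2 * (c M%:R - c (M%:R - 1)) / sum_ratio_gap M.
Proof.
rewrite /revenue_ratio subn1 /= mean_queue_incr /revenue_increment subn1 /=.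
rewrite -natr1 /mean_queue /joining_cost.
have := lt0r_neq0 (sum_ratio_gap_gt0 M); have := lt0r_neq0 (S_gt0 M).
have := lt0r_neq0 (S_gt0 M.+1); have := lt0r_neq0 rho_gt0.
rewrite /sum_ratio_gap (S_recr M.+1) (S_recr M) => h0 h1 h2 h3.
by field; rewrite h0 h1 h2 h3.
Qed.

Lemma cost_le_social_ratio M : c M%:R <= social_ratio rho C1 C2 M.+1.
Proof.
rewrite social_ratioE lerDl divr_ge0 ?(ltW (sum_ratio_gap_gt0 M)) //.
rewrite mulr_ge0 ?(ltW (poisson_weight_gt0 _)) // sumr_ge0 // => m _.
by rewrite mulr_ge0 ?(ltW (poisson_weight_gt0 _)) // subr_ge0 cost_mono // ltnW.
Qed.

(** After cancelling c(M) and the common denominator, convexity bounds each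
    saving c(M) - c(m) by M - m last increments of c, and the inequality for
    log-concave sequences finishes. *)
Lemma social_le_revenue_ratio M :
  social_ratio rho C1 C2 M.+1 <= revenue_ratio rho C1 C2 M.+1.
Proof.
rewrite social_ratioE revenue_ratioE lerD2l ler_pM2r ?invr_gt0 ?sum_ratio_gap_gt0 //.
(* At M = 0 the last increment c(0) - c(-1) may be negative, but both sides
   are empty sums. *)
case: M => [|M].
  by rewrite /cost_saving /poisson_sum !big_ord0 mulr0 !mul0r.
set d := c _ - _.
have d_ge0 : 0 <= d.
  have -> : d = c M.+1%:R - c M%:R by rewrite /d -[X in c (X - 1)]natr1 addrK.
  by rewrite subr_ge0 cost_mono.
have saving_le : cost_saving M.+1 <= d * \sum_(m < M.+1) (M.+1%:R - m%:R) * p m.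
  rewrite mulr_sumr; apply: ler_sum => m _.
  by rewrite [leRHS]mulrA ler_pM2r ?poisson_weight_gt0 //
    [d * _]mulrC cost_convex.
apply: (le_trans (y := p M.+2 * (d * \sum_(m < M.+1) (M.+1%:R - m%:R) * p m))).
  by rewrite ler_pM2l ?poisson_weight_gt0.
rewrite mulrCA mulrC ler_wpM2r //.
exact: (logconcave_linear_gap poisson_weight_gt0 poisson_weight_logconcave).
Qed.

Lemma revenue_ratio1 : revenue_ratio rho C1 C2 1 = 0.
Proof.
by rewrite revenue_ratioE /poisson_sum big_ord0 /joining_cost; ring.
Qed.

Lemma cost_unbounded V : 0 < Num.max C1 C2 -> exists n : nat, V < c n%:R.
Proof.
move=> C_gt0.
have C12 : 0 < C1 + C2.
  by move: C_gt0; rewrite lt_max; case/orP => h;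
    [exact: ltr_pwDl | exact: ltr_wpDl].
exists (Num.bound `|V / (C1 + C2)|); set n := Num.bound _.
have lt_n : V < n%:R * (C1 + C2).
  rewrite -ltr_pdivrMr //; apply: le_lt_trans (ler_norm _) _.
  exact: archi_boundP (normr_ge0 _).
apply: lt_le_trans lt_n _.
(* On integers n <= n^2, so the linear lower bound also covers C1 = 0. *)
have n_sq : n%:R <= n%:R ^+ 2 :> K.
  by rewrite -natrX ler_nat; case: (n) => // k; rewrite leq_pmulr.
by have := ler_wpM2l C2_ge0 n_sq; rewrite /joining_cost; lra.
Qed.

End Comparison.

(** * The thresholds *)

Lemma is_max_exists_unique (P : nat -> Prop) (b : pred nat) (n0 B : nat) :
  (forall n, reflect (P n) (b n)) -> P n0 -> (forall n, P n -> (n <= B)%N) ->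
  exists! n, is_max P n.
Proof.
move=> bP Pn0 P_le.
have ex_b : exists n, b n by exists n0; apply/bP.
have b_le n : b n -> (n <= B)%N by move/bP/P_le.
case: (ex_maxnP ex_b b_le) => n /bP Pn n_max.
exists n; split; first by split=> // N /bP; apply: n_max.
by move=> m [Pm m_max]; apply/eqP; rewrite eqn_leq m_max // n_max //; apply/bP.
Qed.

Theorem theorem4 (K : realType) (Lambda mu R rho C1 C2 : K)
    (hLambda : 0 < Lambda) (hmu : 0 < mu) (hR : 0 < R)
    (hrho : rho = Lambda / mu)
    (hC1 : 0 <= C1) (hC2 : 0 <= C2) (hC : 0 < Num.max C1 C2) :
  [/\ exists! nm : nat, is_revenue_threshold rho R C1 C2 nm,
      exists! ns : nat, is_social_threshold rho R C1 C2 ns,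
      exists! ne : nat, is_equilibrium_threshold R C1 C2 ne
    & forall nm ns ne : nat,
        is_revenue_threshold rho R C1 C2 nm ->
        is_social_threshold rho R C1 C2 ns ->
        is_equilibrium_threshold R C1 C2 ne ->
        (nm <= ns)%N /\ (ns <= ne)%N].
Proof.
have rho_gt0 : 0 < rho by rewrite hrho divr_gt0.
pose c := joining_cost C1 C2.
have c_mono m n : (m <= n)%N -> c m%:R <= c n%:R by apply: cost_mono.
have c_le_social M := cost_le_social_ratio rho_gt0 hC1 hC2 M.
have social_le_revenue M := social_le_revenue_ratio rho_gt0 hC1 hC2 M.
have revenue1 : revenue_ratio rho C1 C2 1 <= R.
  by rewrite revenue_ratio1 // ltW.
have social_leq N n : R < c n%:R ->
    (1 <= N)%N /\ social_ratio rho C1 C2 N <= R -> (N <= n)%N.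
  move=> R_lt; case: N => [[]|M [_ sM]] //; rewrite ltnNge.
  apply/negP => /c_mono le_nM.
  have := lt_le_trans R_lt (le_trans le_nM (le_trans (c_le_social M) sM)).
  by rewrite ltxx.
have revenue_social N : (1 <= N)%N /\ revenue_ratio rho C1 C2 N <= R ->
    (1 <= N)%N /\ social_ratio rho C1 C2 N <= R.
  case: N => [[]|M [_ rM]] //; split=> //.
  exact: le_trans (social_le_revenue M) rM.
have [B R_lt_cB] : exists n : nat, R < c n%:R by apply: cost_unbounded.
have equilibriumE n : is_equilibrium_threshold R C1 C2 n <->
    [/\ (1 <= n)%N, c n.-1%:R <= R & R < c n%:R].
  rewrite /is_equilibrium_threshold /joining_utility.
  case: n => [|n]; first by split=> -[].
  rewrite -natr1 addrK natr1 subr_ge0 subr_lt0.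
  by split=> -[].
split.
- apply: (is_max_exists_unique (n0 := 1%N) (B := B)
    (b := fun N => (1 <= N)%N && (revenue_ratio rho C1 C2 N <= R))) => // n.
    exact: andP.
  by move/revenue_social; apply: social_leq.
- apply: (is_max_exists_unique (n0 := 1%N) (B := B)
    (b := fun N => (1 <= N)%N && (social_ratio rho C1 C2 N <= R))) => [n||n].
  + exact: andP.
  + by apply: revenue_social.
  + exact: social_leq.
- have ex_n : exists n : nat, R < c n%:R by exists B.
  case: (ex_minnP ex_n) => n R_lt n_min.
  have n_gt0 : (1 <= n)%N.
    case: n R_lt {n_min} => // ; rewrite /c /joining_cost expr2 !mulr0 addr0.
    by move/(lt_trans hR); rewrite ltxx.
  exists n; split.
    apply/equilibriumE; split=> //; rewrite leNgt; apply/negP => /n_min.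
    by rewrite -ltnS prednK // ltnn.
  move=> m /equilibriumE[m_gt0 cm R_lt_m]; apply/eqP.
  rewrite eqn_leq n_min //= -(prednK m_gt0) ltnNge.
  apply/negP => /c_mono le_nm.
  by have := lt_le_trans R_lt (le_trans le_nm cm); rewrite ltxx.
- move=> nm ns ne [/revenue_social nmP _] [nsP ns_max] /equilibriumE[_ _ R_lt].
  by split; [apply: ns_max | apply: social_leq nsP].
Qed.
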